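(* Let $M\in\mathbb{R}^{m\times n}$ and $S\in\mathbb{R}^{d\times m}$ with $n\le d\le m$. If the restricted condition number $\kappa(S\,|\,\mathrm{range}(M))$ is finite, then the output $[Q_k,R_k,J]=\mathtt{cqrrpt\_core}(M,S)$, computed in exact arithmetic, defines a column-pivoted QR decomposition of $M$.
   Context: All matrices are real, $X^*$ denotes the transpose, and arithmetic is exact. For a matrix $X$ with $n$ columns and a permutation vector $J$ of $\{1,\dots,n\}$, write $X_k:=X[:,J[1{:}k]]$ (the first $k$ columns after pivoting), so that $X_n=X[:,J]$. ''Orthonormal matrix'' means a matrix with orthonormal columns. QR factors $(Q,R)$ consist of an orthonormal matrix $Q$ and an upper-trapezoidal matrix $R$; for such factors $Q_k$ denotes the first $k$ columns of $Q$ and $R_k$ the first $k$ rows of $R$. Column-pivoted QR decomposition: for a rank-$k$ matrix $X$ with $n$ columns, it consists of QR factors $(Q,R)$ and a length-$n$ permutation vector $J$ such that $X_n=X[:,J]=Q_kR_k$. Restricted singular values: for a linear subspace $L\subset\mathbb{R}^m$, the restricted singular values of $S$ on $L$ are the singular values of $SU$, where $U$ is any orthonormal matrix with range $L$ (they do not depend on $U$). The restricted condition number $\kappa(S|L)$ is the ratio of the largest to the smallest restricted singular value; it is infinite if the smallest one is zero. Thus $\kappa(S|\mathrm{range}(M))$ is finite if and only if $\mathrm{rank}(SM)=\mathrm{rank}(M)$. Algorithm $\mathtt{cqrrpt\_core}(M,S)$: 1. $M^{\mathrm{sk}}=SM$. 2. $[Q^{\mathrm{sk}},R^{\mathrm{sk}},J]=\mathtt{qrcp}(M^{\mathrm{sk}})$,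 where $\mathtt{qrcp}$ is any routine that always returns a column-pivoted QR decomposition of its input. 3. $k=\mathrm{rank}(R^{\mathrm{sk}})$. 4. $M^{\mathrm{pre}}=M_k(A_k^{\mathrm{sk}})^{-1}$, where $M_k=M[:,J[1{:}k]]$ and $A_k^{\mathrm{sk}}=R^{\mathrm{sk}}[1{:}k,1{:}k]$; it is assumed that $\mathtt{qrcp}$ is such that $A_k^{\mathrm{sk}}$ is invertible. 5. $G=(M^{\mathrm{pre}})^*M^{\mathrm{pre}}$. 6. $R^{\mathrm{pre}}=\mathtt{chol}(G)$, the upper-triangular Cholesky factor, $G=(R^{\mathrm{pre}})^*R^{\mathrm{pre}}$. 7. $Q_k=M^{\mathrm{pre}}(R^{\mathrm{pre}})^{-1}$. 8. $R_k=R^{\mathrm{pre}}R_k^{\mathrm{sk}}$, where $R_k^{\mathrm{sk}}=R^{\mathrm{sk}}[1{:}k,:]$. 9. Return $Q_k,R_k,J$.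
   Formalization: A column-pivoted QR decomposition is also required to satisfy X[:,J]=QR, not only X[:,J]=Q_kR_k; without this the rows of R past the k-th are arbitrary, rank(R^sk) can exceed rank(SM), and the Cholesky step fails (e.g. M=0, Q^sk=R^sk=[1]). *)

(* Defs.v *)
From HB Require Import structures.
From mathcomp Require Import all_boot all_order all_fingroup all_algebra.
From mathcomp Require Import boolp classical_sets reals constructive_ereal.

Set Implicit Arguments.
Unset Strict Implicit.
Unset Printing Implicit Defensive.

Import Order.TTheory GRing.Theory Num.Theory.
Local Open Scope ring_scope.

Definition orthonormal_mx (R : realType) (m p : nat) (Q : 'M[R]_(m, p)) : Prop :=
  Q^T *m Q = 1%:M.

Definition upper_trapezoidal (R : realType) (p n : nat) (A : 'M[R]_(p, n)) : Prop :=
  forall (i : 'I_p) (j : 'I_n), (j < i)%N -> A i j = 0.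

Definition first_cols (R : realType) (m n k : nat) (le_kn : (k <= n)%N)
    (X : 'M[R]_(m, n)) : 'M[R]_(m, k) :=
  colsub (widen_ord le_kn) X.

Definition first_rows (R : realType) (p n k : nat) (le_kp : (k <= p)%N)
    (X : 'M[R]_(p, n)) : 'M[R]_(k, n) :=
  rowsub (widen_ord le_kp) X.

(* The inner dimension [qr_width] is part of the data, so that full, economic
   and rank-revealing ("k columns only") factorizations are all covered.
   The permutation vector J is a permutation of 'I_n, and X[:,J] is
   [col_perm J X], whose j-th column is column J j of X. *)
Record pivoted_qr (R : realType) (m n : nat) := PivotedQR {
  qr_width : nat;
  qr_Q : 'M[R]_(m, qr_width);
  qr_R : 'M[R]_(qr_width, n);
  qr_J : 'S_n
}.

(* With k = \rank X: X[:,J] = Q R and X[:,J] = Q_k R_k.  The first equation says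
   that (Q, R) are factors of X[:,J]; it does not imply the second one (the
   nonzero rows of R need not be the leading ones), nor conversely (the rows of
   R after the k-th one would be unconstrained, and R could have rank > k). *)
Definition is_column_pivoted_qr (R : realType) (m n : nat) (X : 'M[R]_(m, n))
    (D : pivoted_qr R m n) : Prop :=
  [/\ orthonormal_mx (qr_Q D),
      upper_trapezoidal (qr_R D),
      col_perm (qr_J D) X = qr_Q D *m qr_R D &
      exists le_kp : (\rank X <= qr_width D)%N,
        col_perm (qr_J D) X =
          first_cols le_kp (qr_Q D) *m first_rows le_kp (qr_R D)].

Definition mxrange (R : realType) (m n : nat) (M : 'M[R]_(m, n)) :
    {vspace 'cV[R]_m} :=
  limg (linfun (mulmx M : 'cV[R]_n -> 'cV[R]_m)).

(* The singular values of A, as the square roots of the eigenvalues of A^T A;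
   multiplicities are dropped.  When A has more columns than rows this set
   contains 0. *)
Definition singular_values (R : realType) (d r : nat) (A : 'M[R]_(d, r)) : set R :=
  [set s : R | 0 <= s /\ eigenvalue (A^T *m A) (s ^+ 2)]%classic.

Definition orthonormal_basis_mx (R : realType) (m : nat) (L : {vspace 'cV[R]_m}) :
    'M[R]_(m, \dim L) :=
  xget 0 [set U | orthonormal_mx U /\ mxrange U = L]%classic.

Definition restricted_singular_values (R : realType) (d m : nat)
    (S : 'M[R]_(d, m)) (L : {vspace 'cV[R]_m}) : set R :=
  singular_values (S *m orthonormal_basis_mx L).

(* The set of restricted singular values is finite, so that its infimum and
   supremum are its smallest and largest elements, except when L = 0: there are
   then no singular values, and the condition number is 1 by convention, so that
   it is finite exactly when S is injective on L. *)
Definition restricted_cond (R : realType) (d m : nat)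
    (S : 'M[R]_(d, m)) (L : {vspace 'cV[R]_m}) : \bar R :=
  let sv := restricted_singular_values S L in
  if \dim L == 0%N then 1%:E
  else if inf sv == 0 then +oo%E
  else (sup sv / inf sv)%:E.

(* The positive diagonal makes the Cholesky factor unique.  The value is
   meaningless (zero) when G is not symmetric positive definite. *)
Definition is_cholesky_factor (R : realType) (k : nat) (G T : 'M[R]_k) : Prop :=
  [/\ upper_trapezoidal T, forall i, 0 < T i i & G = T^T *m T].

Definition chol (R : realType) (k : nat) (G : 'M[R]_k) : 'M[R]_k :=
  xget 0 [set T | is_cholesky_factor G T]%classic.

Definition leading_rows (R : realType) (m n : nat) (D : pivoted_qr R m n) :
    'M[R]_(\rank (qr_R D), n) :=
  first_rows (rank_leq_row (qr_R D)) (qr_R D).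

Definition leading_block (R : realType) (m n : nat) (D : pivoted_qr R m n) :
    'M[R]_(\rank (qr_R D)) :=
  first_cols (rank_leq_col (qr_R D)) (leading_rows D).

Definition cqrrpt_core (R : realType) (m n d : nat)
    (qrcp : 'M[R]_(d, n) -> pivoted_qr R d n)
    (M : 'M[R]_(m, n)) (S : 'M[R]_(d, m)) : pivoted_qr R m n :=
  let Msk := S *m M in
  let D := qrcp Msk in
  let Mk := first_cols (rank_leq_col (qr_R D)) (col_perm (qr_J D) M) in
  let Mpre := Mk *m invmx (leading_block D) in
  let G := Mpre^T *m Mpre in
  let Rpre := chol G in
  let Qk := Mpre *m invmx Rpre in
  let Rk := Rpre *m leading_rows D in
  PivotedQR Qk Rk (qr_J D).

(* Main.v *)
Require Import Defs.
From HB Require Import structures.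
From mathcomp Require Import all_boot all_order all_fingroup all_algebra.
From mathcomp Require Import boolp classical_sets reals constructive_ereal.

Set Implicit Arguments.
Unset Strict Implicit.
Unset Printing Implicit Defensive.

Import Order.TTheory GRing.Theory Num.Theory.
Local Open Scope ring_scope.

(** The sketch [S] is injective on the range of [M], so [M] and [S *m M] have
    the same kernel: every linear relation between columns that is read off the
    sketch already holds for the columns of [M].

    Let [J] and [Rsk] be the permutation and triangular factor of the sketch,
    [k] the rank of [Rsk], [Rk] its first [k] rows and [A] the leading
    [k x k] block.  Since [A] is invertible, [Rk] has rank [k] and hence spans
    the row space of [Rsk]; so the permuted sketch satisfies the relation
    [Y = Y_k A^-1 Rk], where [Y_k] is the block of its first [k] columns.  By
    injectivity the permuted [M] satisfies the same relation, which reads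
    [M_J = Mpre Rk] ([col_perm_preconditioned]).  Sketching does not increase
    the rank, so [k <= \rank M <= \rank Mpre <= k]: [Mpre] has full column
    rank, its Gram matrix is positive definite, and the Cholesky factor [T]
    exists and is invertible ([cholP]).  Then [Mpre T^-1] is orthonormal,
    [T Rk] is upper trapezoidal, and their product is [M_J].  As [k = \rank M],
    keeping the leading [\rank M] columns and rows removes nothing.

    Injectivity itself comes from the condition number: a nonzero vector killed
    by [S *m U], with [U] an orthonormal basis of the range, makes [0] a
    restricted singular value, and the condition number is then infinite
    ([restricted_cond_fin_inj]). *)

(** * Finite condition number and injectivity *)

Lemma inf_singular_values_row_free (R : realType) (d r : nat)
    (A : 'M[R]_(d, r)) :
  inf (singular_values A) != 0 -> row_free A^T.
Proof.
apply: contraNT; rewrite -kermx_eq0 => /rowV0Pn [v /sub_kermxP vA0 v_neq0].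
have sv0 : singular_values A 0.
  split=> //; apply/eigenvalueP; exists v => //.
  by rewrite mulmxA vA0 mul0mx expr0n scale0r.
have lb0 : lbound (singular_values A) 0 by move=> s [].
rewrite eq_le; apply/andP; split.
  by apply: ge_inf => //; exists 0.
by apply: lb_le_inf => //; exists 0.
Qed.

Lemma mem_mxrange (R : realType) (m n : nat) (M : 'M[R]_(m, n)) (x : 'cV[R]_n) :
  M *m x \in mxrange M.
Proof.
have -> : M *m x = linfun (mulmx M : 'cV[R]_n -> 'cV[R]_m) x by rewrite lfunE.
exact/memv_img/memvf.
Qed.

Lemma mxrange_factor (R : realType) (m n r : nat)
    (M : 'M[R]_(m, n)) (U : 'M[R]_(m, r)) :
  mxrange U = mxrange M -> exists C, M = U *m C.
Proof.
move=> eqUM; suff /submxP[C MC] : (M^T <= U^T)%MS.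
  by exists C^T; rewrite -[LHS]trmxK MC trmx_mul trmxK.
apply/row_subP => j; rewrite -tr_col colE.
have := mem_mxrange M (delta_mx j 0); rewrite -eqUM => /memv_imgP [x _ ->].
by rewrite lfunE /= trmx_mul submxMl.
Qed.

(** On a nonzero range a finite condition number means that the smallest
    restricted singular value is nonzero.  This also guarantees that
    [orthonormal_basis_mx] is a genuine basis: its default value is the zero
    matrix, for which all singular values vanish. *)
Lemma restricted_cond_fin_inj (R : realType) (m n d p : nat)
    (M : 'M[R]_(m, n)) (S : 'M[R]_(d, m)) (X : 'M[R]_(n, p)) :
  restricted_cond S (mxrange M) \is a fin_num ->
  S *m M *m X = 0 -> M *m X = 0.
Proof.
rewrite /restricted_cond; case: eqP => [dim0 _ _|/eqP dim_neq0].
  suff -> : M = 0 by rewrite mul0mx.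
  apply/matrixP => i j; have := mem_mxrange M (delta_mx j 0).
  have /eqP -> : mxrange M == 0%VS by rewrite -dimv_eq0 dim0.
  by rewrite memv0 -colE => /eqP /matrixP /(_ i 0); rewrite !mxE.
case: eqP => // /eqP /inf_singular_values_row_free SU_free _ SMX0.
have [U_basis|no_basis] := pselect (exists U : 'M[R]_(m, \dim (mxrange M)),
    orthonormal_mx U /\ mxrange U = mxrange M); last first.
  move: SU_free; rewrite /orthonormal_basis_mx xgetPN; last first.
    by move=> U UP; apply: no_basis; exists U.
  by rewrite mulmx0 trmx0 /row_free mxrank0 eq_sym (negPf dim_neq0).
have [_ /mxrange_factor [C MC]] := xgetPex 0 U_basis.
rewrite -/(orthonormal_basis_mx _) in MC.
have CX0 : C *m X = 0.
  apply/trmx_inj/(row_free_inj SU_free).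
  by rewrite trmx0 mul0mx -trmx_mul mulmxA -(mulmxA S) -MC SMX0 trmx0.
by rewrite MC -mulmxA CX0 mulmx0.
Qed.

(** * Cholesky factorization *)

Definition posdef_mx (R : realType) (k : nat) (G : 'M[R]_k) : Prop :=
  G^T = G /\ forall x : 'cV[R]_k, x != 0 -> 0 < (x^T *m G *m x) 0 0.

Lemma gram_posdef (R : realType) (m k : nat) (X : 'M[R]_(m, k)) :
  row_free X^T -> posdef_mx (X^T *m X).
Proof.
move=> X_free; split=> [|x x_neq0]; first by rewrite trmx_mul trmxK.
have : X *m x != 0.
  apply: contraNneq x_neq0 => Xx0; apply/eqP/trmx_inj/(row_free_inj X_free).
  by rewrite trmx0 mul0mx -trmx_mul Xx0 trmx0.
rewrite mulmxA -trmx_mul -mulmxA; move: (X *m x) => y y_neq0.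
rewrite mxE lt0r sumr_ge0 ?andbT => [|i _]; last by rewrite mxE -expr2 sqr_ge0.
apply: contraNneq y_neq0; under eq_bigr do rewrite mxE -expr2.
move/psumr_eq0P => y0; apply/eqP/colP => i; rewrite mxE.
by apply/eqP; rewrite -sqrf_eq0 y0 // => j _; apply: sqr_ge0.
Qed.

(** Gaussian elimination of the first variable: the Schur complement is the
    quadratic form minimized over that variable, so it stays positive definite,
    and its factor completes the first row of the Cholesky factor. *)
Lemma cholesky_exists (R : realType) (k : nat) (G : 'M[R]_k) :
  posdef_mx G -> exists T, is_cholesky_factor G T.
Proof.
elim: k G => [|k IHk] G [Gsym Gpos].
  by exists 0; split=> [[]|[]|] //; apply/matrixP => -[].
pose a := G 0 0; pose b : 'rV[R]_k := ursubmx (G : 'M_(1 + k)).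
pose C : 'M[R]_k := drsubmx (G : 'M_(1 + k)).
have Gblock : G = block_mx a%:M b b^T C :> 'M_(1 + k).
  rewrite -[LHS](submxK (G : 'M_(1 + k))) /b trmx_ursub Gsym; congr block_mx.
  by apply/rowP => i; rewrite !ord1 !mxE /a; congr (G _ _); apply: val_inj.
have Csym : C^T = C by rewrite /C trmx_drsub Gsym.
have a_gt0 : 0 < a.
  have := Gpos (delta_mx 0 0); rewrite trmx_delta -rowE -colE !mxE; apply.
  by apply/eqP => /matrixP /(_ 0 0) /eqP; rewrite !mxE /= oner_eq0.
have a_neq0 : a != 0 by rewrite gt_eqF.
have [|T [Tup Tpos CT]] := IHk (C - a^-1 *: (b^T *m b)).
  split=> [|y y_neq0].
    by rewrite linearB linearZ /= trmx_mul trmxK Csym.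
  (* -a^-1 (b y) is the first coordinate minimizing the form at fixed y *)
  pose x : 'cV[R]_(1 + k) := col_mx (- a^-1 *: (b *m y)) y.
  have x_neq0 : x != 0.
    by apply: contra y_neq0; rewrite col_mx_eq0 => /andP[].
  have := Gpos x x_neq0; rewrite Gblock.
  have -> : x^T *m block_mx a%:M b b^T C *m x
          = y^T *m (C - a^-1 *: (b^T *m b)) *m y; last by [].
  rewrite -mulmxA mul_block_col /x tr_col_mx mul_row_col.
  rewrite mul_scalar_mx scalerA mulrN divff // scaleN1r addNr mulmx0 add0r.
  rewrite -scalemxAr scaleNr addrC -[RHS]mulmxA mulmxBl -scalemxAl.
  by rewrite -(mulmxA b^T).
pose s := Num.sqrt a.
have s_gt0 : 0 < s by rewrite sqrtr_gt0.
have s_neq0 : s != 0 by rewrite gt_eqF.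
have s2 : s * s = a by rewrite -expr2 sqr_sqrtr // ltW.
pose T' : 'M[R]_(1 + k) := block_mx s%:M (s^-1 *: b) 0 T.
suff: is_cholesky_factor (block_mx a%:M b b^T C) T'.
  by rewrite -Gblock => T'_chol; exists T'.
split.
- move=> i j; case: (split_ordP i) => i' ->; last first.
    case: (split_ordP j) => j' ->; first by rewrite /T' block_mxEdl mxE.
    by rewrite /T' block_mxEdr ltn_add2l => /Tup.
  by rewrite /= ord1.
- move=> i; case: (split_ordP i) => i' ->; last by rewrite /T' block_mxEdr.
  by rewrite /T' block_mxEul ord1 mxE eqxx.
- rewrite /T' tr_block_mx mulmx_block !tr_scalar_mx !trmx0 !mul0mx !addr0.
  rewrite -scalar_mxM s2 !mulmx0 !addr0 mul_scalar_mx mul_mx_scalar.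
  rewrite !linearZ /= -!scalemxAl !scalerA mulVf // !scale1r -CT -invfM s2.
  by rewrite addrC subrK.
Qed.

Lemma cholP (R : realType) (k : nat) (G : 'M[R]_k) :
  posdef_mx G -> is_cholesky_factor G (chol G).
Proof. by move=> /cholesky_exists; apply: xgetPex. Qed.

Lemma cholesky_factor_unit (R : realType) (k : nat) (G T : 'M[R]_k) :
  is_cholesky_factor G T -> T \in unitmx.
Proof.
move=> [Tup Tpos _]; rewrite unitmxE -det_tr det_trig; last first.
  by apply/is_trig_mxP => i j lt_ij; rewrite mxE Tup.
by rewrite unitfE; apply/prodf_neq0 => i _; rewrite mxE gt_eqF.
Qed.

(** * Triangular factors and leading blocks *)

Lemma upper_trapezoidalM (R : realType) (p q n : nat)
    (A : 'M[R]_(p, q)) (B : 'M[R]_(q, n)) :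
  upper_trapezoidal A -> upper_trapezoidal B -> upper_trapezoidal (A *m B).
Proof.
move=> Aup Bup i j lt_ji; rewrite mxE big1 // => l _.
have [/Aup ->|le_il] := ltnP l i; first by rewrite mul0r.
by rewrite Bup ?mulr0 // (leq_trans lt_ji).
Qed.

Lemma first_colsE (R : realType) (m n k : nat) (le_kn : (k <= n)%N)
    (X : 'M[R]_(m, n)) :
  first_cols le_kn X = X *m first_cols le_kn 1%:M.
Proof. by rewrite -[X in LHS]mulmx1 /first_cols -mulmx_colsub. Qed.

Lemma mul_first_cols_rows (R : realType) (m n p r : nat) (le_rp : (r <= p)%N)
    (A : 'M[R]_(m, p)) (B : 'M[R]_(p, n)) :
  r = p -> first_cols le_rp A *m first_rows le_rp B = A *m B.
Proof.
move=> eq_rp; move: le_rp; rewrite eq_rp => le_pp.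
have widen_id i : widen_ord le_pp i = i by apply: val_inj.
by apply/matrixP => i j; rewrite !mxE; apply: eq_bigr => l _; rewrite !mxE widen_id.
Qed.

Lemma mxrank_col_perm (R : realType) (m n : nat) (s : 'S_n) (A : 'M[R]_(m, n)) :
  \rank (col_perm s A) = \rank A.
Proof. by rewrite col_permE mxrankMfree // row_free_unit unitmx_perm. Qed.

Lemma mxrank_orthonormalM (R : realType) (m p n : nat)
    (Q : 'M[R]_(m, p)) (A : 'M[R]_(p, n)) :
  orthonormal_mx Q -> \rank (Q *m A) = \rank A.
Proof.
move=> Q_orth; apply/eqP; rewrite eqn_leq mxrankM_maxr /=.
by rewrite -{1}[A]mul1mx -Q_orth -mulmxA mxrankM_maxr.
Qed.

(** * Preconditioning by the sketch *)

(** The leading rows have the full rank of the triangular factor, because they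
    contain an invertible block of that size; so they span all its rows. *)
Lemma sub_leading_rows (R : realType) (m n : nat) (D : pivoted_qr R m n) :
  leading_block D \in unitmx -> (qr_R D <= leading_rows D)%MS.
Proof.
move=> A_unit; have rows_sub : (leading_rows D <= qr_R D)%MS.
  by rewrite /leading_rows /first_rows -[X in rowsub _ X]mul1mx -mul_rowsub_mx submxMl.
rewrite -(geq_leqif (mxrank_leqif_sup rows_sub)).
by rewrite -{1}(mxrank_unit A_unit) /leading_block first_colsE mxrankM_maxl.
Qed.

(** The relation expressing all columns of the permuted sketch through its first
    [k] columns carries over to [M] by injectivity. *)
Lemma col_perm_preconditioned (R : realType) (m n d : nat)
    (M : 'M[R]_(m, n)) (S : 'M[R]_(d, m)) (D : pivoted_qr R d n) :
  (forall X : 'M[R]_n, S *m M *m X = 0 -> M *m X = 0) ->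
  col_perm (qr_J D) (S *m M) = qr_Q D *m qr_R D ->
  leading_block D \in unitmx ->
  col_perm (qr_J D) M =
    first_cols (rank_leq_col (qr_R D)) (col_perm (qr_J D) M)
      *m invmx (leading_block D) *m leading_rows D.
Proof.
move=> S_inj SMJ A_unit; have /submxP [C RC] := sub_leading_rows A_unit.
rewrite first_colsE; set E := first_cols _ 1%:M.
have AE : leading_block D = leading_rows D *m E by rewrite /leading_block first_colsE.
set A := leading_block D in A_unit AE *; set Rk := leading_rows D in RC AE *.
have Rsk_ker (X : 'M_n) : Rk *m X = 0 -> qr_R D *m X = 0.
  by move=> RkX0; rewrite RC -mulmxA RkX0 mulmx0.
apply/eqP; rewrite -subr_eq0 -!mulmxA -{1}[col_perm _ M]mulmx1 -mulmxBr.
rewrite col_permE -mulmxA S_inj // [LHS]mulmxA -col_permE SMJ -mulmxA.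
rewrite Rsk_ker ?mulmx0 //.
by rewrite mulmxBr mulmx1 !mulmxA -AE mulmxV // mul1mx subrr.
Qed.

Theorem theorem2 (R : realType) (m n d : nat)
    (M : 'M[R]_(m, n)) (S : 'M[R]_(d, m))
    (le_nd : (n <= d)%N) (le_dm : (d <= m)%N)
    (qrcp : 'M[R]_(d, n) -> pivoted_qr R d n)
    (qrcpP : forall X : 'M[R]_(d, n), is_column_pivoted_qr X (qrcp X))
    (Ask_unit : leading_block (qrcp (S *m M)) \in unitmx)
    (cond_fin : restricted_cond S (mxrange M) \is a fin_num) :
  is_column_pivoted_qr M (cqrrpt_core qrcp M S).
Proof.
have [Qsk_orth Rsk_up SMJ _] := qrcpP (S *m M).
have S_inj (X : 'M[R]_n) := @restricted_cond_fin_inj _ _ _ _ _ M S X cond_fin.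
rewrite /cqrrpt_core /=; set D := qrcp (S *m M) in Ask_unit Qsk_orth Rsk_up SMJ *.
have MJ := col_perm_preconditioned S_inj SMJ Ask_unit.
set Mpre := _ *m invmx (leading_block D) in MJ *.
have le_k_rankM : (\rank (qr_R D) <= \rank M)%N.
  by rewrite -(mxrank_orthonormalM _ Qsk_orth) -SMJ mxrank_col_perm mxrankM_maxr.
have le_rankM_pre : (\rank M <= \rank Mpre)%N.
  by rewrite -(mxrank_col_perm (qr_J D)) MJ mxrankM_maxl.
have rankM : \rank M = \rank (qr_R D).
  by apply/eqP; rewrite eqn_leq le_k_rankM (leq_trans le_rankM_pre) ?rank_leq_col.
have pre_free : row_free Mpre^T.
  by rewrite /row_free mxrank_tr eqn_leq rank_leq_col (leq_trans le_k_rankM).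
have T_chol := cholP (gram_posdef pre_free).
have T_unit := cholesky_factor_unit T_chol.
have [T_up _ gramE] := T_chol.
set T := chol _ in T_unit T_up gramE *.
have QR : col_perm (qr_J D) M = Mpre *m invmx T *m (T *m leading_rows D).
  by rewrite -mulmxA (mulmxA (invmx T)) mulVmx // mul1mx.
split=> //=.
- rewrite /orthonormal_mx trmx_mul -mulmxA (mulmxA _ Mpre) gramE mulmxA.
  by rewrite mulmxA -trmx_mul mulmxV // trmx1 mul1mx mulmxV.
- apply: upper_trapezoidalM => // i j lt_ji.
  by rewrite mxE Rsk_up.
- have le_rankM_k : (\rank M <= \rank (qr_R D))%N by rewrite rankM.
  by exists le_rankM_k; rewrite mul_first_cols_rows.
Qed.
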